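(* Let $f:\mathbb{D}\to\mathbb{D}$ be holomorphic, and for $z,w\in\mathbb{D}$ put $\theta_{w,z}=|k_w\rangle\langle k_z|$. For every $z,w\in\mathbb{D}$, $$\Phi_{f,*}(\theta_{w,z})=c_f(z,w)\,|k_{f(w)}\rangle\langle k_{f(z)}|.$$ Consequently, for every $n\ge1$, $$\Phi_{f,*}^{n}(\theta_{w,z})=c_{f^{\circ n}}(z,w)\,|k_{f^{\circ n}(w)}\rangle\langle k_{f^{\circ n}(z)}|.$$
   Context: All inner products are linear in the second variable. $\mathbb{D}$ is the open unit disk, $H^2$ its Hardy space with Szegő kernel $k(z,w)=\frac{1}{1-z\overline w}$, $k_w=k(\cdot,w)$, so $h(w)=\langle k_w,h\rangle$ for $h\in H^2$. $f^{\circ n}$ is the $n$-fold composition of $f$ with itself. $|x\rangle\langle y|$ is the operator $h\mapsto x\langle y,h\rangle$. For any holomorphic $\phi:\mathbb{D}\to\mathbb{D}$, $c_\phi(z,w)=\frac{1-\phi(z)\overline{\phi(w)}}{1-z\overline w}$, a positive definite kernel on $\mathbb{D}$; its reproducing kernel Hilbert space is the de Branges-Rovnyak space $\mathcal{H}(\phi)$, and $c_{\phi,w}=c_\phi(\cdot,w)$. $V_f:H^2\to H^2\otimes\mathcal{H}(f)$ is the isometry determined by $V_fk_w=k_{f(w)}\otimes c_{f,w}$, $w\in\mathbb{D}$, and $\Phi_f(S)=V_f^{*}(S\otimes I_{\mathcal{H}(f)})V_f$ for $S\in B(H^2)$, a normal unital completely positive map. Its preadjoint $\Phi_{f,*}$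 is the map on trace-class operators with $\mathrm{Tr}(\Phi_{f,*}(\rho)S)=\mathrm{Tr}(\rho\,\Phi_f(S))$, and $\Phi_{f,*}^n$ is its $n$-fold iterate. *)

(* Defs.v *)
From HB Require Import structures.
From mathcomp Require Import all_boot all_order all_algebra.
From mathcomp Require Import all_classical all_reals all_analysis.
From mathcomp Require Import complex.

Set Implicit Arguments.
Unset Strict Implicit.
Unset Printing Implicit Defensive.

Import Order.TTheory GRing.Theory Num.Theory.
Import numFieldNormedType.Exports.

Local Open Scope classical_set_scope.
Local Open Scope complex_scope.
Local Open Scope ring_scope.

(** Complex Hilbert spaces; the inner product is linear in the second variable
    and conjugate-linear in the first. *)
HB.mixin Record isHilbert (R : realType) H of CompleteNormedModule R[i] H := {
  inner : H -> H -> R[i];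
  innerDr : forall x y z, inner x (y + z) = inner x y + inner x z;
  innerZr : forall a x y, inner x (a *: y) = a * inner x y;
  inner_conj : forall x y, inner y x = (inner x y)^*;
  inner_norm : forall x, inner x x = `|x| ^+ 2
}.

#[short(type="hilbertType")]
HB.structure Definition Hilbert (R : realType) :=
  {H of isHilbert R H & CompleteNormedModule R[i] H}.

Section Operators.
Context {R : realType}.
Implicit Types H K : hilbertType R.

Definition bounded_op H K (A : H -> K) : Prop :=
  linear A /\ continuous A.

Definition isometric_op H K (V : H -> K) : Prop :=
  linear V /\ forall h, `|V h| = `|h|.

Definition is_adjoint H K (A : H -> K) (B : K -> H) : Prop :=
  forall y x, inner (B y) x = inner y (A x).

Definition ketbra H K (x : K) (y : H) : H -> K := fun h => inner y h *: x.

(** [A] is the absolute value [|T|]: the positive operator with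
    [A * A = T^* * T]. *)
Definition is_abs_op H (T A : H -> H) : Prop :=
  [/\ bounded_op A,
      forall x, 0 <= inner x (A x) &
      forall x y, inner y (A (A x)) = inner (T y) (T x)].

(** Trace class and trace, computed in an orthonormal basis [e]; neither
    depends on the choice of the basis. *)
Definition trace_class H (e : nat -> H) (T : H -> H) : Prop :=
  bounded_op T /\
  exists2 A : H -> H, is_abs_op T A &
    cvgn (series (fun n => inner (e n) (A (e n)) : R[i]^o)).

Definition trace H (e : nat -> H) (T : H -> H) : R[i] :=
  limn (series (fun n => inner (e n) (T (e n)) : R[i]^o)).

(** The preadjoint of a normal map [Phi] on B(H); its values are determined
    by the defining identity, since trace-class operators are separated by the
    functionals [Tr (_ S)].  Only meaningful on trace-class [rho]. *)
Definition preadjoint H (e : nat -> H) (Phi : (H -> H) -> (H -> H))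
    (rho : H -> H) : H -> H :=
  xget (fun=> 0) [set sigma | trace_class e sigma /\
    forall S, bounded_op S -> trace e (sigma \o S) = trace e (rho \o Phi S)].

End Operators.

(** A model of the Hilbert space tensor product of [H] and [K] (unique up to
    unitary equivalence). *)
Record hilbert_tensor (R : realType) (H K : hilbertType R) := HilbertTensor {
  tensor_space :> hilbertType R;
  tens : H -> K -> tensor_space;
  tensDl : forall x x' y, tens (x + x') y = tens x y + tens x' y;
  tensZl : forall a x y, tens (a *: x) y = a *: tens x y;
  tensDr : forall x y y', tens x (y + y') = tens x y + tens x y';
  tensZr : forall a x y, tens x (a *: y) = a *: tens x y;
  inner_tens : forall x x' y y',
    inner (tens x y) (tens x' y') = inner x x' * inner y y';
  tens_dense : dense [set u | exists n (x : 'I_n -> H) (y : 'I_n -> K),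
    u = \sum_(i < n) tens (x i) (y i)]
}.

(** [A] is the operator [S (x) I]. *)
Definition is_amplification (R : realType) (H K : hilbertType R)
    (HK : hilbert_tensor H K) (S : H -> H) (A : HK -> HK) : Prop :=
  bounded_op A /\ forall x y, A (tens HK x y) = tens HK (S x) y.

(** A Hilbert space of complex functions on [X]: the values [fval h z] for
    [z] in [X] identify [h] with a function; values outside [X] are junk. *)
Record hilbert_fun_space (R : realType) (T : Type) (X : set T) :=
  HilbertFunSpace {
  fun_space :> hilbertType R;
  fval : fun_space -> T -> R[i];
  fval_linear : forall a g h z, X z ->
    fval (a *: g + h) z = a * fval g z + fval h z;
  fval_inj : forall g h, (forall z, X z -> fval g z = fval h z) -> g = h
}.

Section FunctionSpaces.
Context {R : realType} {T : Type} {X : set T}.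

(** The element of [H] which, as a function on [X], is [phi]. *)
Definition fun_elt (H : hilbert_fun_space R X) (phi : T -> R[i]) : H :=
  xget 0 [set h | forall z, X z -> fval h z = phi z].

(** [H] is the reproducing kernel Hilbert space of the kernel [k]. *)
Definition is_rkhs (H : hilbert_fun_space R X) (k : T -> T -> R[i]) : Prop :=
  forall w, X w -> exists2 kw : H,
    forall z, X z -> fval kw z = k z w &
    forall h, fval h w = inner kw h.

End FunctionSpaces.

Section Disk.
Context {R : realType}.
Local Notation C := R[i].

Definition disk : set C := [set z | `|z| < 1].

Definition holomorphic_self_map (f : C -> C) : Prop :=
  (forall z, disk z -> disk (f z)) /\
  (forall z, disk z -> derivable (f : C^o -> C^o) z 1).

(** Power series with square-summable coefficients, normed by the l^2 norm of
    the coefficients. *)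
Definition is_hardy (H : hilbert_fun_space R disk) : Prop :=
  (forall h : H, exists a : nat -> C,
     (forall z, disk z ->
        series (fun n => a n * z ^+ n : C^o) @ \oo --> (fval h z : C^o)) /\
     series (fun n => `|a n| ^+ 2 : C^o) @ \oo --> (`|h| ^+ 2 : C^o)) /\
  (forall a : nat -> C, cvgn (series (fun n => `|a n| ^+ 2 : C^o)) ->
     exists h : H, forall z, disk z ->
       series (fun n => a n * z ^+ n : C^o) @ \oo --> (fval h z : C^o)).

(** The orthonormal basis of monomials [z ^+ n] of the Hardy space. *)
Definition monomials (H : hilbert_fun_space R disk) (n : nat) : H :=
  fun_elt H (fun z => z ^+ n).

Definition szego (z w : C) : C := (1 - z * w^*)^-1.

Definition cker (phi : C -> C) (z w : C) : C :=
  (1 - phi z * (phi w)^*) / (1 - z * w^*).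

Definition kvec (H : hilbert_fun_space R disk) (w : C) : H :=
  fun_elt H (szego ^~ w).

Definition cvec (phi : C -> C) (H : hilbert_fun_space R disk) (w : C) : H :=
  fun_elt H (cker phi ^~ w).

End Disk.

(* Main.v *)
(** The monomials form an orthonormal basis of the Hardy space, so for a
    continuous linear functional [L] the trace of [|x><L|] is [L x].  Hence
    [Tr (|x><y| S) = <y, S x>], and [Tr (|k_w><k_z| Phi S)] equals
    [<V k_z, (S (x) I) V k_w>], that is [<k_f(z), S k_f(w)> * <c_z, c_w>] with
    [<c_z, c_w> = cker f z w].  Testing against rank-one [S] shows that this
    identity determines the preadjoint.  Iterating gives the product of the
    [cker f (f^k z) (f^k w)], which telescopes to the kernel of the iterate. *)
Require Import Defs.
From HB Require Import structures.
From mathcomp Require Import all_boot all_order all_algebra.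
From mathcomp Require Import all_classical all_reals all_analysis.
From mathcomp Require Import complex.
From mathcomp Require Import ring.

Set Implicit Arguments.
Unset Strict Implicit.
Unset Printing Implicit Defensive.

Import Order.TTheory GRing.Theory Num.Theory.
Import numFieldNormedType.Exports.

Local Open Scope classical_set_scope.
Local Open Scope complex_scope.
Local Open Scope ring_scope.

(** * Sesquilinearity, polarization and continuity of the inner product *)

Section InnerProduct.
Context {R : realType} (H : hilbertType R).
Implicit Types x y z : H.

Lemma innerDl x y z : inner (x + y) z = inner x z + inner y z.
Proof. by rewrite inner_conj innerDr rmorphD /= -!inner_conj. Qed.

Lemma innerZl a x y : inner (a *: x) y = a^* * inner x y.
Proof. by rewrite inner_conj innerZr rmorphM /= -inner_conj. Qed.

Lemma inner0r x : inner x 0 = 0.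
Proof. by rewrite -(scale0r (0 : H)) innerZr mul0r. Qed.

Lemma innerNr x y : inner x (- y) = - inner x y.
Proof. by rewrite -scaleN1r innerZr mulN1r. Qed.

Lemma innerBr x y z : inner x (y - z) = inner x y - inner x z.
Proof. by rewrite innerDr innerNr. Qed.

Lemma inner_sumr I (r : seq I) (P : pred I) (F : I -> H) x :
  inner x (\sum_(i <- r | P i) F i) = \sum_(i <- r | P i) inner x (F i).
Proof.
apply: (big_morph (inner x)); first by move=> y z; rewrite innerDr.
exact: inner0r.
Qed.

Lemma inner_ext x y : (forall z, inner z x = inner z y) -> x = y.
Proof.
move=> xy; apply/eqP; rewrite -subr_eq0 -normr_eq0 -sqrf_eq0 -inner_norm.
by rewrite innerBr xy subrr.
Qed.

(** The first bracket is twice the real part of [inner x y], the second minus twice its imaginary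
    part. This turns convergence of norms into convergence of inner products. *)
Lemma inner_polar x y : inner x y = 2^-1 *
  ((`|x + y| ^+ 2 - `|x| ^+ 2 - `|y| ^+ 2) -
    'i * (`|x + 'i *: y| ^+ 2 - `|x| ^+ 2 - `|y| ^+ 2)).
Proof.
rewrite -!inner_norm !(innerDr, innerDl, innerZr, innerZl) conjCi.
set a := inner x x; set b := inner y y; set p := inner x y; set q := inner y x.
have i2 : 'i * 'i = -1 :> R[i] by rewrite -expr2 sqrCi.
apply: (@mulfI _ 2); first by rewrite pnatr_eq0.
rewrite mulVKf ?pnatr_eq0//; symmetry.
(* Keeping ['i * 'i] explicit lets [ring] treat ['i] as an indeterminate until [i2] is applied. *)
transitivity (q + p + ('i * 'i) * q - ('i * 'i) * p + 'i * (('i * 'i) * b + b)).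
  by ring.
by rewrite i2; ring.
Qed.

Lemma inner_cvg (T : Type) (F : set_system T) {FF : Filter F} x
    (u : T -> H) y :
  u t @[t --> F] --> y -> (inner x (u t) : R[i]^o) @[t --> F] --> (inner x y : R[i]^o).
Proof.
move=> uy.
have sqr_cvg (v : T -> H) z : v t @[t --> F] --> z ->
    (`|v t| ^+ 2 : R[i]^o) @[t --> F] --> (`|z| ^+ 2 : R[i]^o).
  move=> vz.
  by under eq_fun do rewrite expr2; rewrite expr2; apply: cvgM; apply: cvg_norm.
under eq_fun do rewrite inner_polar; rewrite inner_polar.
apply: cvgM; first exact: cvg_cst.
apply: cvgB.
  apply: cvgB; last exact: sqr_cvg.
  apply: cvgB; last exact: cvg_cst.
  by apply: sqr_cvg; apply: cvgD => //; exact: cvg_cst.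
apply: cvgM; first exact: cvg_cst.
apply: cvgB; last exact: sqr_cvg.
apply: cvgB; last exact: cvg_cst.
by apply: sqr_cvg; apply: cvgD; [exact: cvg_cst|apply: cvgZl_tmp].
Qed.

End InnerProduct.

(** * Bounded operators and the functionals they induce *)

Section BoundedOperators.
Context {R : realType}.
Implicit Types H K : hilbertType R.

Lemma inner_linear H (y : H) : linear (inner y : H -> R[i]^o).
Proof. by move=> a u v; rewrite innerDr innerZr. Qed.

Lemma inner_continuous H (y : H) : continuous (inner y : H -> R[i]^o).
Proof. by move=> h; exact: inner_cvg. Qed.

Lemma bounded_op_functional H K (y : K) (A : H -> K) : bounded_op A ->
  linear (inner y \o A : H -> R[i]^o) /\
  continuous (inner y \o A : H -> R[i]^o).
Proof.
move=> [Alin Acont]; split; first by move=> a u v; rewrite /= Alin innerDr innerZr.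
by move=> h; apply: cvg_comp; [exact: Acont|exact: inner_continuous].
Qed.

Lemma bounded_op_comp H K (L : hilbertType R) (A : K -> L) (B : H -> K) :
  bounded_op A -> bounded_op B -> bounded_op (A \o B).
Proof.
move=> [Alin Acont] [Blin Bcont]; split; first by move=> a u v; rewrite /= Blin Alin.
by move=> h; apply: cvg_comp; [exact: Bcont|exact: Acont].
Qed.

Lemma isometric_op_bounded H K (V : H -> K) : isometric_op V -> bounded_op V.
Proof.
move=> [Vlin Vnorm]; split=> // h; apply/cvgrPdist_lt => eps eps0.
have /cvgrPdist_lt/(_ _ eps0) : (fun x : H => x) @ h --> h by exact: cvg_id.
by apply: filterS => x; rewrite -Vnorm (zmod_morphism_linear Vlin).
Qed.

End BoundedOperators.

(** * Rank-one operators and their absolute values *)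

Section RankOne.
Context {R : realType} (H : hilbertType R).
Implicit Types x y : H.

Lemma ketbra_scale a x y : a \*: ketbra x y = ketbra (a *: x) y :> (H -> H).
Proof. by apply/funext => h; rewrite /ketbra /= !scalerA mulrC. Qed.

Lemma ketbra_bounded x y : bounded_op (ketbra x y : H -> H).
Proof.
split; first by move=> a u v; rewrite /ketbra innerDr innerZr scalerDl scalerA.
move=> h; apply: cvgZr_tmp; exact: inner_cvg.
Qed.

(* At [y = 0] the coefficient is the junk value [0], and both sides vanish. *)
Lemma ketbra_abs x y :
  is_abs_op (ketbra x y : H -> H) (ketbra ((`|x| / `|y|) *: y) y).
Proof.
split; first exact: ketbra_bounded.
  move=> h; rewrite /ketbra !innerZr mulrCA mulr_ge0//.
  by rewrite [inner h y]inner_conj mul_conjC_ge0.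
move=> u v; rewrite /ketbra !(innerZr, innerZl) [inner v y]inner_conj !inner_norm.
have [->|y0] := eqVneq y 0.
  by rewrite normr0 invr0 [inner 0 _]inner_conj inner0r conjC0 !(mul0r, mulr0).
have : `|y| != 0 by rewrite normr_eq0.
by move=> ny; field.
Qed.

End RankOne.

(** * Traces of rank-one operators and uniqueness of the preadjoint *)

Section Expansion.
Context {R : realType} (H : hilbertType R) (e : nat -> H).

Definition expands :=
  forall x, series (fun n => inner (e n) x *: e n) @ \oo --> x.

Hypothesis eP : expands.

Lemma expands_functional (L : H -> R[i]) x :
  linear (L : H -> R[i]^o) -> continuous (L : H -> R[i]^o) ->
  series (fun n => inner (e n) x * L (e n) : R[i]^o) @ \oo --> (L x : R[i]^o).
Proof.
move=> Llin Lcont.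
have LD : {morph L : u v / u + v} by move=> u v; have := Llin 1 u v; rewrite !scale1r.
have LZ a u : L (a *: u) = a * L u by exact: (scalable_linear Llin).
have L0 : L 0 = 0 by rewrite -(scale0r (0 : H)) LZ mul0r.
have -> : series (fun n => inner (e n) x * L (e n) : R[i]^o) =
    L \o series (fun n => inner (e n) x *: e n).
  apply/funext => n; rewrite /series /= (big_morph L LD L0).
  by apply: eq_bigr => i _; rewrite LZ.
by apply: cvg_comp; [exact: eP|exact: Lcont].
Qed.

(** The trace is the sum of [inner (e n) x * L (e n)], which is [L] applied to the expansion of [x].
    With a functional in place of a bra, [ketbra x y \o S] is covered without forming the adjoint of
    [S]. *)
Lemma trace_ketbra_comp (L : H -> R[i]) (T : H -> H) x :
  linear (L : H -> R[i]^o) -> continuous (L : H -> R[i]^o) ->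
  (forall h, T h = L h *: x) -> trace e T = L x.
Proof.
move=> Llin Lcont TE; rewrite /trace.
under eq_fun do rewrite TE innerZr mulrC.
by apply: (@cvg_lim R[i]^o); [exact: norm_hausdorff|exact: expands_functional].
Qed.

(** The absolute value is again rank one, so its diagonal series is the expansion of [y] under a
    continuous functional. *)
Lemma ketbra_trace_class x y : trace_class e (ketbra x y : H -> H).
Proof.
split; first exact: ketbra_bounded.
exists (ketbra ((`|x| / `|y|) *: y) y); first exact: ketbra_abs.
set z := _ *: y.
apply: (cvgP (inner y z : R[i]^o)).
under eq_fun do rewrite /ketbra innerZr mulrC.
by apply: expands_functional; [exact: inner_linear|exact: inner_continuous].
Qed.

(* Testing against the rank-one operators recovers all the matrix entries. *)
Lemma trace_separates (sigma tau : H -> H) : bounded_op sigma -> bounded_op tau ->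
  (forall S, bounded_op S -> trace e (sigma \o S) = trace e (tau \o S)) ->
  sigma = tau.
Proof.
move=> bs bt st; apply/funext => u; apply: inner_ext => v.
have tr (rho : H -> H) : bounded_op rho ->
    trace e (rho \o ketbra u v) = inner v (rho u).
  move=> [rlin _].
  apply: (trace_ketbra_comp (inner_linear v) (@inner_continuous _ _ v)) => h.
  exact: (scalable_linear rlin).
by rewrite -tr// st ?tr//; exact: ketbra_bounded.
Qed.

(** The witness [sigma] rules out the default of [xget], and [trace_separates] makes the chosen
    operator equal to it. *)
Lemma preadjointE (Phi : (H -> H) -> (H -> H)) (rho sigma : H -> H) :
  trace_class e sigma ->
  (forall S, bounded_op S -> trace e (sigma \o S) = trace e (rho \o Phi S)) ->
  preadjoint e Phi rho = sigma.
Proof.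
move=> sT sP; rewrite /preadjoint; case: xgetP => [tau _ [[bt _] tP]|]; last first.
  by move=> /(_ sigma) [].
by apply: trace_separates => //; [case: sT|move=> S bS; rewrite tP// sP].
Qed.

End Expansion.

(** * Uniqueness of bounded power series coefficients *)

Section PowerSeries.
Context {R : realType}.
Local Notation C := R[i].
Implicit Types a b : nat -> C.

Lemma square_summable_bounded a :
  cvgn (series (fun n => `|a n| ^+ 2 : C^o)) ->
  exists M, forall n, `|a n| <= M.
Proof.
move=> /cvg_series_cvg_0 a0.
have [M [Mr aM]] := cvg_seq_bounded (cvgP _ a0).
exists (1 + (M + 1)) => n.
have := aM (M + 1); rewrite ltrDl ltr01 => /(_ isT) /(_ n I) /=.
rewrite ger0_norm ?exprn_ge0// => aM1.
(* Only the squares are known to be bounded; [t <= 1 + t ^+ 2] passes to the coefficients. *)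
apply: le_trans (_ : 1 + `|a n| ^+ 2 <= _); last by rewrite lerD2l.
have [a1|a1] := real_leP (normr_real (a n)) (real1 _).
  by apply: le_trans a1 _; rewrite lerDl exprn_ge0.
by rewrite expr2 -[X in X <= _]add0r lerD// ler_peMl// ltW.
Qed.

(* If [a m] is the first nonzero coefficient and [r] is small, then [a m * r ^+ m]
   dominates the rest of the series. *)
Lemma power_series_eq0 a M : (forall n, `|a n| <= M) ->
  (forall z, disk z -> series (fun n => a n * z ^+ n : C^o) @ \oo --> (0 : C^o)) ->
  forall n, a n = 0.
Proof.
move=> aM a0; elim/ltn_ind => n IH; apply/eqP/negPn/negP => an0.
have al0 : 0 < `|a n| by rewrite normr_gt0.
have M0 : 0 < M := lt_le_trans al0 (aM n).
have M40 : 0 < 4 * M by rewrite mulr_gt0.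
(* The factor 4 gives [r <= 1/2], so geometric sums are at most 2, and makes the tail bound
   [M * r ^+ n.+1 * 2] exactly half of the leading term. *)
pose r : C := `|a n| / (4 * M).
have r0 : 0 < r by rewrite divr_gt0.
have r2 : r * 2 <= 1.
  rewrite /r mulrAC ler_pdivrMr// mul1r mulrC ler_pM// ?ler_nat//.
have r1 : r < 1 by apply: lt_le_trans r2; rewrite mulr_natr mulr2n ltrDl.
have geo k : \sum_(i < k) r ^+ i <= 2.
  elim: k => [|k IHk]; first by rewrite big_ord0.
  rewrite big_ord_recl expr0; under eq_bigr do rewrite /= exprS.
  rewrite -mulr_sumr -[leRHS]/(1 + 1) lerD2l; apply: le_trans r2.
  by rewrite ler_pM2l.
have half : 0 < `|a n| * r ^+ n / 2 by rewrite divr_gt0// mulr_gt0// exprn_gt0.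
have dr : disk r by rewrite /disk /= gtr0_norm.
(* This partial sum consists of [n] vanishing terms, the leading term and [N] tail terms; its norm
   is shown to be at least half the leading term. *)
have /cvgr0Pnorm_lt/(_ _ half) [N _ /(_ (n.+1 + N)%N)] := a0 r dr.
rewrite /= leq_addl => /(_ isT).
rewrite /series /= big_mkord big_split_ord /= big_ord_recr /= big1 ?add0r; last first.
  by move=> i _; rewrite IH ?mul0r.
apply/negP; rewrite -real_leNgt ?normr_real ?gtr0_real//.
apply: le_trans (lerB_normD _ _).
have rX k : `|r ^+ k| = r ^+ k by rewrite ger0_norm// exprn_ge0// ltW.
rewrite normrM rX lerBrDr.
have split_half : `|a n| * r ^+ n = `|a n| * r ^+ n / 2 + M * (r ^+ n.+1 * 2).
  by rewrite exprS /r; field; rewrite ?pnatr_eq0 ?gt_eqF.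
rewrite [leRHS]split_half lerD2l; apply: le_trans (ler_norm_sum _ _ _) _.
apply: le_trans (_ : \sum_(i < N) M * (r ^+ n.+1 * r ^+ i) <= _).
  apply: ler_sum => i _; rewrite normrM -exprD rX.
  by rewrite ler_pM2r// exprn_gt0.
by rewrite -!mulr_sumr ler_pM2l// ler_pM2l ?exprn_gt0.
Qed.

Lemma series_delta (F : nat -> C) n : (forall m, m != n -> F m = 0) ->
  series (F : nat -> C^o) @ \oo --> (F n : C^o).
Proof.
move=> F0; apply: cvg_near_cst; exists n.+1 => //= N nN.
rewrite /series /= big_mkord (bigD1 (Ordinal nN)) //= big1 ?addr0// => i ni.
by apply: F0.
Qed.

End PowerSeries.

Lemma fun_eltE (R : realType) (T : Type) (X : set T) (H : hilbert_fun_space R X)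
    (phi : T -> R[i]) (h : H) :
  (forall z, X z -> fval h z = phi z) -> fun_elt H phi = h.
Proof.
move=> hphi; apply: fval_inj => z Xz; rewrite hphi// /fun_elt.
by case: xgetP => [g _ ->|/(_ h)].
Qed.

(** * Taylor coefficients and the monomial basis of the Hardy space *)

Section Hardy.
Context {R : realType} (H : hilbert_fun_space R (@disk R)).
Hypothesis hardyH : is_hardy H.
Local Notation C := R[i].
Implicit Types (g h : H) (a b : nat -> C).

Definition taylor h a :=
  (forall z, disk z ->
     series (fun n => a n * z ^+ n : C^o) @ \oo --> (fval h z : C^o)) /\
  series (fun n => `|a n| ^+ 2 : C^o) @ \oo --> (`|h| ^+ 2 : C^o).

Lemma taylor_ex h : exists a, taylor h a.
Proof. by case: hardyH => + _ => /(_ h) [a]; exists a. Qed.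

Lemma taylor_bounded h a : taylor h a -> exists M, forall n, `|a n| <= M.
Proof. by move=> [_ /cvgP]; exact: square_summable_bounded. Qed.

(** The difference is a bounded sequence whose power series vanishes on the disk. Thus a bounded [b]
    with the right pointwise sums inherits the norm identity of [a]. *)
Lemma taylor_eq h a b M : (forall n, `|b n| <= M) ->
  (forall z, disk z ->
     series (fun n => b n * z ^+ n : C^o) @ \oo --> (fval h z : C^o)) ->
  taylor h a -> a = b.
Proof.
move=> bM bh ah; have [M' aM'] := taylor_bounded ah.
apply/funext => n; apply/eqP; rewrite -subr_eq0; apply/eqP.
apply: (@power_series_eq0 _ (fun n => a n - b n) (M' + M)) n => [n|z dz].
  by apply: le_trans (ler_normB _ _) (lerD _ _).
have -> : series (fun n => (a n - b n) * z ^+ n : C^o) =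
    series (fun n => a n * z ^+ n : C^o) - series (fun n => b n * z ^+ n : C^o).
  apply/funext => n; rewrite /series /= !fctE -sumrB.
  by apply: eq_bigr => i _; rewrite mulrBl.
rewrite -(subrr (fval h z)).
by apply: cvgB; [case: ah => + _; apply|exact: bh].
Qed.

(** Only the pointwise sums are computed; the norm identity comes from the coefficients that
    [is_hardy] provides, identified by [taylor_eq]. *)
Lemma taylorP c g h a b : taylor g a -> taylor h b ->
  taylor (c *: g + h) (fun n => c * a n + b n).
Proof.
move=> ga hb; have [d dP] := taylor_ex (c *: g + h).
have [M aM] := taylor_bounded ga; have [M' bM'] := taylor_bounded hb.
suff <- : d = (fun n => c * a n + b n) by [].
apply: (@taylor_eq _ _ _ (`|c| * M + M')) dP => [n|z dz].
  apply: le_trans (ler_normD _ _) _; rewrite lerD// normrM.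
  by rewrite ler_wpM2l.
rewrite fval_linear//.
have -> : series (fun n => (c * a n + b n) * z ^+ n : C^o) =
  (fun n => c * series (fun n => a n * z ^+ n : C^o) n +
           series (fun n => b n * z ^+ n : C^o) n).
  apply/funext => n; rewrite /series /= mulr_sumr -big_split /=.
  by apply: eq_bigr => i _; rewrite mulrDl mulrA.
apply: cvgD; last by case: hb => + _; apply.
apply: cvgM; first exact: cvg_cst.
by case: ga => + _; apply.
Qed.

(** Since [is_hardy] prescribes norms only, polarization is applied both in the space and to each
    term of the series. *)
Lemma taylor_inner g h a b : taylor g a -> taylor h b ->
  series (fun n => (a n)^* * b n : C^o) @ \oo --> (inner g h : C^o).
Proof.
move=> ga hb.
have nrm c : series (fun n => `|a n + c * b n| ^+ 2 : C^o) @ \oo -->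
    (`|g + c *: h| ^+ 2 : C^o).
  rewrite addrC; under eq_fun do rewrite addrC.
  by case: (taylorP c hb ga).
rewrite inner_polar.
pose S c := series (fun n => `|a n + c * b n| ^+ 2 : C^o).
pose A := series (fun n => `|a n| ^+ 2 : C^o).
pose B := series (fun n => `|b n| ^+ 2 : C^o).
have -> : series (fun n => (a n)^* * b n : C^o) =
    (fun n => 2^-1 * ((S 1 n - A n - B n) - 'i * (S 'i n - A n - B n))).
  apply/funext => n; rewrite /S /A /B /series /= -!sumrB !mulr_sumr -!sumrB mulr_sumr.
  apply: eq_bigr => i _; rewrite mul1r !normCKC !rmorphD !rmorphM /= conjCi.
  apply: (@mulfI _ 2); first by rewrite pnatr_eq0.
  rewrite mulVKf ?pnatr_eq0//.
  set p := a i; set q := b i; set p' := p^*; set q' := q^*.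
  have i2 : 'i * 'i = -1 :> C by rewrite -expr2 sqrCi.
  symmetry; transitivity (p' * q + q' * p + ('i * 'i) * (q' * p) - ('i * 'i) * (p' * q)
    + 'i * (('i * 'i) * (q' * q) + q' * q)); first by ring.
  by rewrite i2; ring.
have ha : A n @[n --> \oo] --> (`|g| ^+ 2 : C^o) by case: ga.
have hB : B n @[n --> \oo] --> (`|h| ^+ 2 : C^o) by case: hb.
have hS c : S c n @[n --> \oo] --> (`|g + c *: h| ^+ 2 : C^o) by exact: nrm.
have hD c : (fun n => S c n - A n - B n) @ \oo -->
    (`|g + c *: h| ^+ 2 - `|g| ^+ 2 - `|h| ^+ 2 : C^o).
  by apply: cvgB hB; apply: cvgB ha; exact: hS.
apply: cvgM; first exact: cvg_cst.
apply: cvgB; first by have := hD 1; rewrite scale1r.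
by apply: cvgM; [exact: cvg_cst|exact: hD].
Qed.

Lemma taylor_monomials n : taylor (monomials H n) (fun m => (m == n)%:R).
Proof.
set d := fun m => _.
have d0 m : m != n -> d m = 0 by rewrite /d => /negbTE ->.
have [|h hP] := hardyH.2 d.
  apply: (cvgP (`|d n| ^+ 2 : C^o)); apply: (@series_delta R (fun m => `|d m| ^+ 2) n).
  by move=> m /d0 ->; rewrite normr0 expr0n.
have hz z : disk z -> fval h z = z ^+ n.
  move=> dz; apply: (cvg_unique (@norm_hausdorff _ C^o) (hP z dz)).
  (* Writes the limit as [d n * z ^+ n], the one surviving term. *)
  rewrite -[z ^+ n]mul1r -[1]/(true%:R) -(eqxx n).
  by apply: (@series_delta R (fun m => d m * z ^+ m) n) => m /d0 ->; rewrite mul0r.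
have -> : monomials H n = h.
  exact: fun_eltE.
have [b bP] := taylor_ex h.
suff <- : b = d by [].
apply: (@taylor_eq h b d 1) => // m.
by rewrite /d; case: eqP => _; rewrite ?normr1 ?normr0.
Qed.

Lemma inner_monomials n h a : taylor h a -> inner (monomials H n) h = a n.
Proof.
move=> ha; apply: (cvg_unique (@norm_hausdorff _ C^o) (taylor_inner (taylor_monomials n) ha)).
have -> : a n = ((n == n)%:R : C)^* * a n by rewrite eqxx conjC1 mul1r.
apply: (@series_delta R (fun m => ((m == n)%:R : C)^* * a m) n) => m /negbTE ->.
by rewrite conjC0 mul0r.
Qed.

(** By orthonormality the squared distance from [x] to the partial sum is the squared norm of [x]
    minus the partial sum of the squared coefficients, which tends to 0. *)
Lemma monomials_expands : expands (monomials H).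
Proof.
move=> x; have [a xa] := taylor_ex x.
under eq_fun do rewrite (inner_monomials _ xa).
set s := series _.
have ortho n m : inner (monomials H n) (monomials H m) = (n == m)%:R.
  by rewrite (inner_monomials _ (taylor_monomials m)).
have dist N : `|x - s N| ^+ 2 = `|x| ^+ 2 - series (fun n => `|a n| ^+ 2) N.
  have sx : inner x (s N) = series (fun n => `|a n| ^+ 2) N.
    rewrite /s /series /= inner_sumr; apply: eq_bigr => i _.
    by rewrite innerZr [inner x _]inner_conj (inner_monomials _ xa) normCK.
  have ss : inner (s N) (s N) = series (fun n => `|a n| ^+ 2) N.
    rewrite {2}/s /series /= inner_sumr; apply: eq_big_nat => i /andP[_ iN].
    rewrite innerZr [inner (s N) _]inner_conj /s /series /= inner_sumr.
    rewrite big_mkord (bigD1 (Ordinal iN))//= innerZr ortho eqxx mulr1.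
    rewrite big1 ?addr0 ?normCK// => j ji.
    have /negbTE ij : i != j by rewrite eq_sym.
    by rewrite innerZr ortho ij mulr0.
  have xs : inner (s N) x = series (fun n => `|a n| ^+ 2) N.
    rewrite inner_conj sx /series /= rmorph_sum; apply: eq_bigr => i _.
    by rewrite /= geC0_conj ?exprn_ge0.
  rewrite -inner_norm innerBr [inner _ x]inner_conj [inner _ (s N)]inner_conj.
  rewrite !innerBr !rmorphB /= -!inner_conj sx ss xs inner_norm.
  by ring.
apply/cvgrPdist_lt => eps eps0.
have e2 : 0 < eps ^+ 2 by rewrite exprn_gt0.
case: xa => _ /cvgrPdist_lt /(_ _ e2); apply: filterS => N /=.
rewrite -dist ger0_norm ?exprn_ge0//.
by rewrite ltr_pXn2r// nnegrE// ltW.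
Qed.

End Hardy.

(** * The kernel of the symbol and the action of the preadjoint *)

Lemma inner_adjr (R : realType) (H K : hilbertType R) (A : H -> K) (B : K -> H) :
  is_adjoint A B -> forall x y, inner x (B y) = inner (A x) y.
Proof. by move=> AB x y; rewrite inner_conj AB -inner_conj. Qed.

Lemma inner_cvec (R : realType) (f : R[i] -> R[i])
    (Hf : hilbert_fun_space R (@disk R)) z w :
  is_rkhs Hf (cker f) -> disk z -> disk w ->
  inner (cvec f Hf z) (cvec f Hf w) = cker f z w.
Proof.
move=> HfP dz dw; have [kz kzP repr] := HfP z dz; have [kw kwP _] := HfP w dw.
have -> : cvec f Hf z = kz by exact: fun_eltE.
have -> : cvec f Hf w = kw by exact: fun_eltE.
by rewrite -repr kwP.
Qed.

Lemma one_sub_mulC_neq0 (R : realType) (z w : R[i]) :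
  disk z -> disk w -> 1 - z * w^* != 0.
Proof.
rewrite /disk /= => dz dw; rewrite subr_eq0; apply/negP => /eqP/(congr1 Num.norm).
rewrite normr1 normrM norm_conjC => zw.
have : `|z| * `|w| < 1 by rewrite -[ltRHS](mulr1 1) ltr_pM.
by rewrite -zw ltxx.
Qed.

Theorem proposition5p1 (R : realType) (f : R[i] -> R[i])
    (f_holo : holomorphic_self_map f)
    (H2 : hilbert_fun_space R (@disk R)) (H2P : is_hardy H2)
    (Hf : hilbert_fun_space R (@disk R)) (HfP : is_rkhs Hf (cker f))
    (HT : hilbert_tensor H2 Hf)
    (V : H2 -> HT) (V_isometric : isometric_op V)
    (V_kvec : forall w, disk w ->
       V (kvec H2 w) = tens HT (kvec H2 (f w)) (cvec f Hf w))
    (Vadj : HT -> H2) (VadjP : is_adjoint V Vadj)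
    (ampl : (H2 -> H2) -> (HT -> HT))
    (amplP : forall S, bounded_op S -> is_amplification S (ampl S)) :
  let Phi S := Vadj \o ampl S \o V in
  let Phi_pre := preadjoint (monomials H2) Phi in
  let theta w z := ketbra (kvec H2 w) (kvec H2 z) in
  (forall z w, disk z -> disk w ->
     Phi_pre (theta w z) =
     cker f z w \*: ketbra (kvec H2 (f w)) (kvec H2 (f z))) /\
  (forall n z w, (1 <= n)%N -> disk z -> disk w ->
     iter n Phi_pre (theta w z) =
     cker (iter n f) z w \*:
       ketbra (kvec H2 (iter n f w)) (kvec H2 (iter n f z))).
Proof.
move=> Phi Phi_pre theta.
have eP := monomials_expands H2P.
have [f_disk _] := f_holo.
(* The scalar [a] is carried along because iteration feeds multiples of [theta] back into [Phi_pre],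
   which is defined by choice and not as a linear map. *)
have Phi_preE a z w : disk z -> disk w -> Phi_pre (a \*: theta w z) =
    (a * cker f z w) \*: theta (f w) (f z).
  move=> dz dw; rewrite /theta !ketbra_scale.
  apply: (preadjointE eP); first exact: ketbra_trace_class.
  move=> S bS; have [bA AE] := amplP S bS.
  have [Llin Lcont] := bounded_op_functional (kvec H2 (f z)) bS.
  rewrite (@trace_ketbra_comp _ _ _ eP _ _
    ((a * cker f z w) *: kvec H2 (f w)) Llin Lcont)//=.
  have [Llin' Lcont'] := bounded_op_functional (V (kvec H2 z))
    (bounded_op_comp bA (isometric_op_bounded V_isometric)).
  (* Moving [Vadj] across the inner product shows that the functional is [inner (V (kvec H2 z))]
     after [ampl S \o V]. *)
  rewrite (@trace_ketbra_comp _ _ _ eP _ _ (a *: kvec H2 w) Llin' Lcont')/=; last first.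
    by move=> h; rewrite /ketbra /Phi /= (inner_adjr VadjP).
  have -> : inner (kvec H2 (f z)) (S ((a * cker f z w) *: kvec H2 (f w))) =
      a * cker f z w * inner (kvec H2 (f z)) (S (kvec H2 (f w))).
    exact: (scalable_linear Llin).
  have -> : inner (V (kvec H2 z)) (ampl S (V (a *: kvec H2 w))) =
      a * inner (V (kvec H2 z)) (ampl S (V (kvec H2 w))).
    exact: (scalable_linear Llin').
  by rewrite !V_kvec// AE inner_tens inner_cvec// -mulrA [cker f z w * _]mulrC.
split=> [z w dz dw|].
  have := Phi_preE 1 z w dz dw; rewrite mul1r => <-; congr Phi_pre.
  by apply/funext => h; rewrite /= scale1r.
have iter_disk n z : disk z -> disk (iter n f z).
  by move=> dz; elim: n => //= n IH; exact: f_disk.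
move=> [//|n] z w _ dz dw; elim: n => [|n IH].
  have := Phi_preE 1 z w dz dw; rewrite mul1r => <- /=; congr Phi_pre.
  by apply/funext => h; rewrite /= scale1r.
rewrite iterS IH Phi_preE; [|exact: iter_disk..]; congr (_ \*: _).
have nz := one_sub_mulC_neq0 dz dw.
have nz' := one_sub_mulC_neq0 (iter_disk n.+1 _ dz) (iter_disk n.+1 _ dw).
(* The denominator of the new factor is the numerator of the kernel of the previous iterate; [nz']
   allows the cancellation. *)
by rewrite /cker !iterS mulrC mulrA divfK.
Qed.
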